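(* Let $q$ be an odd prime power, let $V_6=V(6,q)$ be a 6-dimensional vector space over $\mathrm{GF}(q)$ with basis $e_1,\dots,e_6$ and dual basis $f_1,\dots,f_6$ of $V_6^{\ast}$, and let $\mu\in\mathrm{GF}(q)$ be a non-square. Let $T$ be the alternating trilinear form on $V_6$ given by the dual trivector $$t=f_{123}+\mu\,(f_{156}-f_{246}+f_{345}),\qquad f_{ijk}:=f_i\wedge f_j\wedge f_k .$$ Then the set $\mathcal{L}_T$ of all $T$-singular lines is a Desarguesian line-spread in $\mathrm{PG}(5,q)=\mathbb{P}V_6$.
   Context: A dual trivector $t\in\wedge^3V_n^{\ast}$ gives the alternating trilinear form $T(x,y,z)=\langle t\,|\,x\wedge y\wedge z\rangle$, where the pairing is determined by linearity and $\langle g_1\wedge g_2\wedge g_3\,|\,v_1\wedge v_2\wedge v_3\rangle=\det[g_i(v_j)]$ for $g_i\in V_n^{\ast}$, $v_j\in V_n$. Equivalently, if $t=\sum_{i<j<k}c_{ijk}f_{ijk}$ then $T(e_i,e_j,e_k)=c_{ijk}$ for $i<j<k$. A line $\langle a,b\rangle$ of $\mathbb{P}V_n$ (a 2-dimensional subspace of $V_n$ spanned by linearly independent $a,b$) is $T$-singular if $T(a,b,x)=0$ for all $x\in V_n$; $\mathcal{L}_T$ denotes the set of all $T$-singular lines. A line-spread in $\mathbb{P}V_n$ is a set of lines such that each point of $\mathbb{P}V_n$ lies on precisely one line of the set. A line-spread in $\mathrm{PG}(5,q)=\mathbb{P}V_6$ is Desarguesian if $V_6$ can be given the structure of a 3-dimensional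 vector space over $\mathrm{GF}(q^2)$, extending its $\mathrm{GF}(q)$-vector space structure, in such a way that the lines of the spread are exactly the 1-dimensional $\mathrm{GF}(q^2)$-subspaces, i.e. (for any $\rho\in\mathrm{GF}(q^2)\setminus\mathrm{GF}(q)$) the lines $\langle a,\rho a\rangle$, $0\ne a\in V_6$. *)

(* Defs.v *)
From HB Require Import structures.
From mathcomp Require Import all_boot all_order all_algebra all_field.

Set Implicit Arguments.
Unset Strict Implicit.
Unset Printing Implicit Defensive.

Import GRing.Theory.
Local Open Scope ring_scope.

(* The dual trivector g1 /\ g2 /\ g3, given through its pairing with the
   trivectors x /\ y /\ z. *)
Definition wedge3 (F : fieldType) (V : vectType F) (g1 g2 g3 : {scalar V})
    (x y z : V) : F :=
  \det (\matrix_(i < 3, j < 3)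
          tnth [tuple g1 : V -> F; g2 : V -> F; g3 : V -> F] i
               (tnth [tuple x; y; z] j)).

(* f_ijk for the basis f dual to e; i, j, k are numbered from 1 to 6. *)
Definition dual_wedge (F : fieldType) (V : vectType F) (e : 6.-tuple V)
    (i j k : nat) : V -> V -> V -> F :=
  let f m : {scalar V} := coord e (inord m.-1) in
  wedge3 (f i) (f j) (f k).

Definition form_T (F : fieldType) (V : vectType F) (e : 6.-tuple V) (mu : F)
    (x y z : V) : F :=
  dual_wedge e 1 2 3 x y z
  + mu * (dual_wedge e 1 5 6 x y z - dual_wedge e 2 4 6 x y z
          + dual_wedge e 3 4 5 x y z).

(* Points and lines of PV are the subspaces of V of dimension 1 and 2. *)
Definition singular_line (F : fieldType) (V : vectType F)
    (T : V -> V -> V -> F) (L : {vspace V}) : Prop :=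
  exists a b : V,
    [/\ free [:: a; b], L = <<[:: a; b]>>%VS & forall x, T a b x = 0].

Definition line_spread (F : fieldType) (V : vectType F)
    (S : {vspace V} -> Prop) : Prop :=
  (forall L, S L -> \dim L = 2%N) /\
  (forall P : {vspace V}, \dim P = 1%N -> exists! L, S L /\ (P <= L)%VS).

(* [scale] makes the additive group of V a K-vector space, extending its
   F-vector space structure. *)
Definition extends_scalars (F : fieldType) (V : vectType F)
    (K : fieldExtType F) (scale : K -> V -> V) : Prop :=
  [/\ forall k l v, scale k (scale l v) = scale (k * l) v,
      forall v, scale 1 v = v,
      forall k u v, scale k (u + v) = scale k u + scale k v,
      forall k l v, scale (k + l) v = scale k v + scale l v
    & forall (c : F) v, scale c%:A v = c *: v].

Definition scale_basis (F : fieldType) (V : vectType F)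
    (K : fieldExtType F) (scale : K -> V -> V) (n : nat)
    (b : 'I_n -> V) : Prop :=
  forall v, exists! c : {ffun 'I_n -> K}, v = \sum_(i < n) scale (c i) (b i).

(* Over a finite field F = GF(q), an extension K of degree 2 is GF(q^2). *)
Definition desarguesian_line_spread (F : finFieldType) (V : vectType F)
    (S : {vspace V} -> Prop) : Prop :=
  line_spread S /\
  exists (K : fieldExtType F) (scale : K -> V -> V),
    [/\ \dim {:K} = 2%N,
        extends_scalars scale,
        exists b : 'I_3 -> V, scale_basis scale b
      & forall L : {vspace V}, S L <->
          exists a : V, a != 0 /\
            forall v, v \in L <-> exists k : K, v = scale k a].

(* Main.v *)
(* Let delta be a square root of mu in K = GF(q^2), and identify V_6 with K^3 by
   w_i = x_i + delta x_{i+3}. In these coordinates T(a,b,c) is the GF(q)-part of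
   the K-determinant det(a,b,c), so the coefficients of T(a,b,-) are, up to signs
   and factors mu, the GF(q)-components of the cross product a x b over K. Hence
   T(a,b,-) = 0 exactly when a and b are K-proportional, and the T-singular lines
   are the 1-dimensional K-subspaces. *)
Require Import Defs.
From HB Require Import structures.
From mathcomp Require Import all_boot all_order all_algebra all_field.
From mathcomp Require Import ring.

Import GRing.Theory.
Local Open Scope ring_scope.

(** * The spread of 1-dimensional K-subspaces *)

Section ExtendedScalars.

Set Implicit Arguments.
Unset Strict Implicit.

Variables (F : fieldType) (V : vectType F) (K : fieldExtType F) (delta : K).
Hypothesis basisK : basis_of {:K} [:: 1; delta].
Variable scale : K -> V -> V.
Hypothesis scaleE : extends_scalars scale.

Let line a := <<[:: a; scale delta a]>>%VS.

Lemma scale_injl (a : V) : a != 0 -> injective (scale^~ a).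
Proof.
case: scaleE => sA s1 sDr sDl sF a0 k l /= E.
have s0 v : scale 0 v = 0 by rewrite -(scale0r (1 : K)) sF scale0r.
have sr0 m : scale m 0 = 0 by apply: (addrI (scale m 0)); rewrite -sDr !addr0.
apply/eqP; rewrite -subr_eq0; apply: contraNT a0 => kl0.
by rewrite -(s1 a) -(mulVf kl0) -sA sDl E -sDl subrr s0 sr0.
Qed.

(** Since K = F + F delta, the K-multiples of [a] are exactly the F-combinations of [a] and delta
    [a]. *)
Lemma memv_scale_line (a v : V) : v \in line a <-> exists k, v = scale k a.
Proof.
case: scaleE => sA s1 sDr sDl sF; rewrite /line span_cons span_seq1; split.
  case/memv_addP=> _ /vlineP[c ->] [_ /vlineP[d ->] ->].
  by exists (c%:A + d *: delta); rewrite sDl sF -mulr_algl -sA sF.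
case=> k ->; have: k \in {:K}%VS by rewrite memvf.
rewrite -(span_basis basisK) span_cons span_seq1.
case/memv_addP=> _ /vlineP[c ->] [_ /vlineP[d ->] ->].
by rewrite sDl sF -mulr_algl -sA sF memv_add ?memvZ ?memv_line.
Qed.

(** Independence of 1 and delta is carried to V by the injective F-linear map k -> k [a]. *)
Lemma free_scale_line (a : V) : a != 0 -> free [:: a; scale delta a].
Proof.
case: (scaleE) => sA s1 sDr sDl sF a0.
have := basis_free basisK; rewrite !free_cons !span_seq1 !nil_free !span_nil.
rewrite !memv0 !andbT => /andP[n1 d0]; apply/andP; split.
  apply: contra n1 => /vlineP[c ac]; apply/vlineP; exists c.
  by apply: (scale_injl a0); rewrite /= s1 -mulr_algl -sA sF.
apply: contra d0 => /eqP E; apply/eqP/(scale_injl a0); rewrite /= E.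
by rewrite -(scale0r (1 : K)) sF scale0r.
Qed.

(** A point spanned by [p] lies on K[p]. If it also lies on K[a], then [p] = k [a] with k nonzero,
    hence invertible, so K[a] = K[p]. *)
Lemma scalar_lines_line_spread (S : {vspace V} -> Prop) :
  (forall L, S L <-> exists a, a != 0 /\
     forall v, v \in L <-> exists k, v = scale k a) ->
  line_spread S.
Proof.
case: (scaleE) => sA s1 sDr sDl sF SE.
have lineE (L : {vspace V}) a : (forall v, v \in L <-> exists k, v = scale k a) -> L = line a.
  by move=> La; apply/vspaceP=> v; apply/idP/idP=> [/La|] /memv_scale_line // /La.
split=> [L /SE[a [a0 /lineE->]] | P P1].
  by rewrite /line; have /eqP := free_scale_line a0.
have p0 : vpick P != 0 by rewrite vpick0 -dimv_eq0 P1.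
have Pp : P = <[vpick P]>%VS.
  by apply/eqP; rewrite eq_sym eqEdim -memvE memv_pick dim_vline p0 P1.
rewrite Pp; move: (vpick P) p0 => p p0.
exists (line p); split.
  split; first by apply/SE; exists p; split=> // v; apply: memv_scale_line.
  by rewrite -memvE; apply/memv_scale_line; exists 1; rewrite s1.
move=> L' [/SE[a [a0 La]]]; rewrite -memvE => /La[k pk].
have k0 : k != 0.
  by apply: contraNneq p0 => k0; rewrite pk k0 -(scale0r (1 : K)) sF scale0r.
apply/esym/lineE => v; split=> [/La[l ->] | [l ->]].
  by exists (l / k); rewrite pk sA mulfVK.
by apply/La; exists (l * k); rewrite pk sA.
Qed.

End ExtendedScalars.

(** * The quadratic extension by a square root of mu *)

Section SquareRoot.

Set Implicit Arguments.
Unset Strict Implicit.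

Variables (F : fieldType) (mu : F).

Lemma square_root_extension : ~ (exists x : F, x ^+ 2 = mu) ->
  exists (K : fieldExtType F) (delta : K),
    delta ^+ 2 = mu%:A /\ basis_of {:K} [:: 1; delta].
Proof.
move=> nsq; pose p := 'X^2 - mu%:P.
have sp : size p = 3 by rewrite size_XnsubC.
have [|K dimK [delta rt _]] := @irredp_FAdjoin F p.
  (* In degree 2 or 3, having no root in F is enough for irreducibility. *)
  apply: cubic_irreducible => [|x]; first by rewrite sp.
  by apply/negP; rewrite rootE !hornerE subr_eq0 => /eqP sq; apply: nsq; exists x.
have d2 : delta ^+ 2 = mu%:A.
  move: rt; rewrite rootE rmorphB /= map_polyXn map_polyC /= !hornerE.
  by rewrite subr_eq0 => /eqP.
exists K, delta; split=> //.
rewrite basisEfree subvf dimK sp leqnn !andbT.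
rewrite free_cons seq1_free span_seq1; apply/andP; split.
  (* A relation 1 = c delta would put delta = 1/c in F, making mu a square there. *)
  apply/negP=> /vlineP[c cd]; apply: nsq; exists c^-1.
  have c0 : c != 0.
    by apply: contra_eq_neq cd => ->; rewrite scale0r oner_eq0.
  have dE : c^-1 *: 1 = delta by rewrite cd scalerA mulVf // scale1r.
  apply: (fmorph_inj (in_alg K)).
  by rewrite rmorphXn /= dE d2.
apply/eqP=> d0; apply: nsq; exists 0; apply: (fmorph_inj (in_alg K)).
by rewrite /= -d2 d0 !expr0n /= scale0r.
Qed.

Variables (K : fieldExtType F) (delta : K).
Hypotheses (delta_sq : delta ^+ 2 = mu%:A) (basisK : basis_of {:K} [:: 1; delta]).

Definition re (k : K) : F := coord [tuple 1; delta] 0 k.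
Definition im (k : K) : F := coord [tuple 1; delta] 1 k.

Lemma re_im (k : K) : k = (re k)%:A + im k *: delta.
Proof.
have /(coord_basis (X := [tuple 1; delta]) basisK) : k \in {:K}%VS by rewrite memvf.
rewrite !big_ord_recl big_ord0 addr0 => {1}->; congr (_ + _).
by rewrite (_ : lift ord0 ord0 = 1) //; apply: val_inj.
Qed.

Lemma re_comb (x y : F) : re (x%:A + y *: delta) = x.
Proof.
have fr : free [tuple 1; delta] := basis_free basisK.
have c0 := coord_free 0 0 fr; have c1 := coord_free 1 0 fr.
by rewrite /re linearD !linearZ /= c0 c1 /= mulr1 mulr0 addr0.
Qed.

Lemma im_comb (x y : F) : im (x%:A + y *: delta) = y.
Proof.
have fr : free [tuple 1; delta] := basis_free basisK.
have c0 := coord_free 0 1 fr; have c1 := coord_free 1 1 fr.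
by rewrite /im linearD !linearZ /= c0 c1 /= mulr1 mulr0 add0r.
Qed.

(** The relation delta^2 = mu produces the factor mu that also appears in the trivector. *)
Lemma mul_comb (x y z t : F) :
  (x%:A + y *: delta) * (z%:A + t *: delta)
  = (x * z + mu * (y * t))%:A + (x * t + y * z) *: delta.
Proof.
rewrite mulrDl !mulrDr -!scalerAl -!scalerAr !mul1r mulr1 -expr2 delta_sq.
rewrite !scalerA [_ *: delta + _%:A]addrC addrACA -!scalerDl.
by rewrite [y * t * mu]mulrC.
Qed.

End SquareRoot.

(** Terms are grouped by the last argument, so that the coefficients of T(a,b,-) can be read off. *)
Lemma wedge3E (F : fieldType) (V : vectType F) (g1 g2 g3 : {scalar V}) (x y z : V) :
  wedge3 g1 g2 g3 x y z
  = (g1 x * g2 y - g2 x * g1 y) * g3 z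
    - (g1 x * g3 y - g3 x * g1 y) * g2 z
    + (g2 x * g3 y - g3 x * g2 y) * g1 z.
Proof.
rewrite /wedge3 (expand_det_row _ 0) !big_ord_recl big_ord0 /cofactor.
rewrite !(expand_det_row _ 0) !big_ord_recl !big_ord0 /cofactor !det_mx11 !mxE.
rewrite /= /bump /= !(tnth_nth (g1 : V -> F)) !(tnth_nth x) /=.
rewrite !exprS !expr0.
ring.
Qed.

(** * Identification of V with K^3 *)

Section SingularLines.

Set Implicit Arguments.
Unset Strict Implicit.

Variables (F : fieldType) (V : vectType F) (e : 6.-tuple V) (mu : F).
Hypothesis e_basis : basis_of fullv e.
Variables (K : fieldExtType F) (delta : K).
Hypotheses (delta_sq : delta ^+ 2 = mu%:A) (basisK : basis_of {:K} [:: 1; delta]).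

(** Indices start at 0 here: [c m] is the dual basis vector f_(m+1). *)
Let c (m : nat) (v : V) : F := coord e (inord m) v.

Definition to_row (v : V) : 'rV[K]_3 :=
  \row_(i < 3) ((c i v)%:A + c i.+3 v *: delta).

Definition of_row (w : 'rV[K]_3) : V :=
  \sum_(i < 3) (re delta (w 0 i) *: e`_i + im delta (w 0 i) *: e`_i.+3).

Lemma coord_inord m n : (m < 6)%N -> (n < 6)%N -> c m e`_n = (m == n)%:R.
Proof.
move=> m6 n6; rewrite /c -[in e`_n](@inordK 5 n) // coord_free ?(basis_free e_basis) //.
by rewrite -val_eqE /= !inordK // eq_sym.
Qed.

Lemma to_rowK : cancel to_row of_row.
Proof.
move=> v; rewrite [RHS](coord_basis e_basis (memvf v)) /of_row.
(* The six coordinates split into the indices i and i + 3, for i < 3. *)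
rewrite big_split (@big_split_ord _ _ _ 3 3); congr (_ + _); apply: eq_bigr => i _.
  rewrite mxE re_comb //; congr (coord e _ v *: _).
  by apply: val_inj; rewrite /= inordK // (ltn_trans (ltn_ord i)).
rewrite mxE im_comb //; congr (coord e _ v *: _).
by apply: val_inj; rewrite /= inordK //; have := ltn_ord i; rewrite -(ltn_add2l 3).
Qed.

Lemma of_rowK : cancel of_row to_row.
Proof.
move=> w; apply/rowP=> i; rewrite mxE [RHS](re_im basisK) /of_row.
have cE m : c m (of_row w) = \sum_(j < 3)
    (re delta (w 0 j) * c m e`_j + im delta (w 0 j) * c m e`_j.+3).
  rewrite /c linear_sum; apply: eq_bigr => j _.
  by rewrite linearD !linearZ.
have lt6 (j : 'I_3) : (j < 6)%N by rewrite (ltn_trans (ltn_ord j)).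
have lt6' (j : 'I_3) : (j.+3 < 6)%N := ltn_ord j.
(* The two blocks of indices are disjoint, so a single term survives in each coordinate sum
   below. *)
have ne3 (j k : 'I_3) : ((j == k.+3 :> nat) = false) * ((k.+3 == j :> nat) = false).
  by rewrite eq_sym; split; apply: gtn_eqF; apply: leq_trans (ltn_ord j) _.
congr (_%:A + _ *: _); rewrite cE (bigD1 i) //= big1 => [|j /negPf ji].
- by rewrite !coord_inord // ne3 eqxx mulr0 mulr1 !addr0.
- by rewrite !coord_inord // ne3 (inj_eq val_inj) eq_sym ji !mulr0 addr0.
- by rewrite !coord_inord // ne3 eqxx mulr0 mulr1 add0r addr0.
- by rewrite !coord_inord // ne3 !eqSS (inj_eq val_inj) eq_sym ji !mulr0 addr0.
Qed.

Lemma to_rowD : {morph to_row : u v / u + v}.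
Proof.
move=> u v; apply/rowP=> i; rewrite !mxE /c !linearD !scalerDl.
by rewrite addrACA.
Qed.

Lemma to_rowZ (a : F) (v : V) : to_row (a *: v) = a%:A *: to_row v.
Proof.
apply/rowP=> i; rewrite !mxE /c !linearZ /= mulr_algl scalerDr !scalerA.
by [].
Qed.

(** The K-structure of K^3, transported along the bijection [to_row]. *)
Definition scale_row (k : K) (v : V) : V := of_row (k *: to_row v).

Lemma to_row_scale (k : K) (v : V) : to_row (scale_row k v) = k *: to_row v.
Proof. exact: of_rowK. Qed.

Lemma scale_row_extends : extends_scalars scale_row.
Proof.
have inj := can_inj to_rowK.
split=> [k l v | v | k u v | k l v | a v]; apply: inj;
  rewrite ?(to_rowD, to_row_scale) ?to_rowZ //.
- by rewrite scalerA.
- by rewrite scale1r.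
- by rewrite scalerDr.
- by rewrite scalerDl.
Qed.

Lemma scale_row_basis : scale_basis scale_row (fun i => of_row 'e_i).
Proof.
move=> v.
have sumE (f : {ffun 'I_3 -> K}) :
    to_row (\sum_(i < 3) scale_row (f i) (of_row 'e_i)) = \row_i f i.
  have to_row0 : to_row 0 = 0.
    by apply: (addrI (to_row 0)); rewrite -to_rowD !addr0.
  rewrite (big_morph _ to_rowD to_row0) [RHS]row_sum_delta.
  by apply: eq_bigr => i _; rewrite to_row_scale of_rowK mxE.
exists [ffun i => to_row v 0 i]; split.
  by apply: (can_inj to_rowK); rewrite sumE; apply/rowP=> i; rewrite mxE ffunE.
by move=> f ->; apply/ffunP=> i; rewrite ffunE sumE mxE.
Qed.

(** Plücker coordinates over F of the line spanned by [a] and [b]. *)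
Let p (a b : V) (m n : nat) : F := c m a * c n b - c n a * c m b.

Lemma form_TE (a b x : V) :
  form_T e mu a b x =
    (p a b 1 2 + mu * p a b 4 5) * c 0%N x - (p a b 0 2 + mu * p a b 3 5) * c 1%N x
    + (p a b 0 1 + mu * p a b 3 4) * c 2%N x
    + mu * ((p a b 1 5 - p a b 2 4) * c 3%N x - (p a b 0 5 - p a b 2 3) * c 4%N x
            + (p a b 0 4 - p a b 1 3) * c 5%N x).
Proof.
rewrite /form_T /dual_wedge !wedge3E /= /p /c.
ring.
Qed.

(* p i j + mu p i' j' and p i j' - p j i' (with i' = i + 3) are the two
   GF(q)-components of the K-minor; they are also the coefficients in form_TE. *)
Lemma to_row_minorE (a b : V) (i j : 'I_3) :
  to_row a 0 i * to_row b 0 j = to_row a 0 j * to_row b 0 i <->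
  p a b i j + mu * p a b i.+3 j.+3 = 0 /\ p a b i j.+3 - p a b j i.+3 = 0.
Proof.
rewrite !mxE !(mul_comb delta_sq) /p; split=> [E | [Er Ei]].
  have := congr1 (re delta) E; have := congr1 (im delta) E.
  rewrite !im_comb // !re_comb // => /eqP; rewrite -subr_eq0 => /eqP Ei.
  move=> /eqP; rewrite -subr_eq0 => /eqP Er.
  by split; [rewrite -Er | rewrite -Ei]; ring.
congr (_%:A + _ *: _); apply/eqP; rewrite -subr_eq0; apply/eqP.
  by rewrite -Er; ring.
by rewrite -Ei; ring.
Qed.

(** * Singular lines are K-lines *)

Hypothesis mu_neq0 : mu != 0.

(** The six coefficients in [form_TE] are, up to sign and the nonzero factor mu, the two
    F-components of the three K-minors of the rows of [a] and [b]. *)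
Lemma singular_minorsP (a b : V) :
  (forall x, form_T e mu a b x = 0) <->
  (forall i j, to_row a 0 i * to_row b 0 j = to_row a 0 j * to_row b 0 i).
Proof.
split=> [T0 | minors x].
  (* Evaluation at the basis vectors isolates the coefficients one by one. *)
  have Te m (m6 : (m < 6)%N) := T0 e`_m.
  have E0 := Te 0%N erefl; have E1 := Te 1%N erefl; have E2 := Te 2%N erefl.
  have E3 := Te 3%N erefl; have E4 := Te 4%N erefl; have E5 := Te 5%N erefl.
  move: E0 E1 E2 E3 E4 E5 {Te}; rewrite !form_TE !coord_inord //=.
  rewrite !(mulr0, mulr1, addr0, add0r, subr0, sub0r, oppr0, mulrN).
  move=> E0 /eqP; rewrite oppr_eq0 => /eqP E1 E2.
  move=> /eqP; rewrite mulf_eq0 (negPf mu_neq0) => /eqP E3.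
  move=> /eqP; rewrite oppr_eq0 mulf_eq0 (negPf mu_neq0) => /eqP E4.
  move=> /eqP; rewrite mulf_eq0 (negPf mu_neq0) => /eqP E5.
  (* Minors are antisymmetric in i and j, so the pairs 01, 02 and 12 suffice; they use [E2] and
     [E5], [E1] and [E4], [E0] and [E3] respectively. *)
  have lt_minor (i j : 'I_3) : (i < j)%N ->
      to_row a 0 i * to_row b 0 j = to_row a 0 j * to_row b 0 i.
    move=> ij; apply/to_row_minorE; move: i j ij.
    by case=> [[|[|[|//]]] i3] [[|[|[|//]]] j3].
  move=> i j; case: (ltngtP i j) => [/lt_minor // | /lt_minor-> // | ij].
  by rewrite (val_inj ij).
have m i j (i3 : (i < 3)%N) (j3 : (j < 3)%N) :=
  (to_row_minorE a b (Ordinal i3) (Ordinal j3)).1 (minors _ _).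
have /= [u01 v01] := m 0%N 1%N isT isT.
have /= [u02 v02] := m 0%N 2%N isT isT.
have /= [u12 v12] := m 1%N 2%N isT isT.
rewrite form_TE u01 u02 u12 v01 v02 v12.
by ring.
Qed.

(** Vanishing of all 2 x 2 minors means proportionality over K: a nonzero entry a_i of the row of
    [a] gives the factor b_i / a_i. *)
Lemma singular_scaleP (a b : V) : a != 0 ->
  (forall x, form_T e mu a b x = 0) <-> exists k, b = scale_row k a.
Proof.
move=> a0; rewrite singular_minorsP; split=> [minors | [k ->] i j]; last first.
  by rewrite to_row_scale !mxE mulrCA [RHS]mulrCA [X in _ * X = _]mulrC.
have /rV0Pn[i ai] : to_row a != 0.
  apply: contraNneq a0 => ra0; apply/eqP/(can_inj to_rowK); rewrite ra0.
  by apply: (addrI (to_row 0)); rewrite -to_rowD !addr0.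
exists (to_row b 0 i / to_row a 0 i); apply: (can_inj to_rowK).
rewrite to_row_scale; apply/rowP=> j; rewrite [RHS]mxE mulrAC; apply: (mulfI ai).
by rewrite minors mulrCA divff // mulr1 mulrC.
Qed.

Lemma singular_line_scaleP (L : {vspace V}) :
  singular_line (form_T e mu) L <->
  exists a, a != 0 /\ forall v, v \in L <-> exists k, v = scale_row k a.
Proof.
have ext := scale_row_extends.
split=> [[a [b [fab -> /singular_scaleP sing]]] | [a [a0 La]]].
  have a0 : a != 0 by move: fab; rewrite free_cons; apply: contraTneq => ->; rewrite mem0v.
  exists a; split=> // v; rewrite -(memv_scale_line basisK ext).
  suff -> : <<[:: a; b]>>%VS = <<[:: a; scale_row delta a]>>%VS by [].
  (* The left side has dimension 2 and the right side at most 2, so inclusion is enough. *)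
  apply/eqP; rewrite eqEdim (eqP fab) dim_span andbT.
  apply/span_subvP=> w; rewrite !inE => /orP[] /eqP->.
    by rewrite memv_span ?mem_head.
  by apply/(memv_scale_line basisK ext)/sing.
exists a, (scale_row delta a); split; first exact: (free_scale_line basisK ext).
  apply/vspaceP=> v; apply/idP/idP.
    by move=> /La /(memv_scale_line basisK ext).
  by move=> /(memv_scale_line basisK ext) /La.
by apply/singular_scaleP=> //; exists delta.
Qed.

End SingularLines.

Theorem theorem5 (F : finFieldType) (V : vectType F) (e : 6.-tuple V) (mu : F)
    (q_odd : odd #|F|) (e_basis : basis_of fullv e)
    (mu_nonsquare : ~ exists x : F, x ^+ 2 = mu) :
  desarguesian_line_spread (singular_line (form_T e mu)).
Proof.
have [K [delta [delta_sq basisK]]] := square_root_extension mu_nonsquare.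
have mu0 : mu != 0.
  by apply/eqP=> mu0; apply: mu_nonsquare; exists 0; rewrite mu0 expr0n.
have ext := scale_row_extends e_basis basisK.
(* This description of the singular lines yields both the spread property and its Desarguesian
   structure. *)
have lines := singular_line_scaleP e_basis delta_sq basisK mu0.
split; first exact: (scalar_lines_line_spread basisK ext lines).
exists K, (scale_row e delta); split=> //.
  by have /eqP := basis_free basisK; rewrite (span_basis basisK).
by eexists; exact: (scale_row_basis e_basis basisK).
Qed.
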